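(* Let $X$ be a continuum such that $\mathcal{NB}^{\ast}(\mathcal{F}_1(X))$ is finite. Then $\mathcal{S}(X)$ is finite, and $$\mathcal{NWC}(X)=\mathcal{NB}(\mathcal{F}_1(X))=\mathcal{NB}^{\ast}(\mathcal{F}_1(X))=\mathcal{S}(X).$$
   Context: A continuum is a compact connected metric space; a subcontinuum of $X$ is a non-empty closed connected subset of $X$. $2^X$ denotes the hyperspace of all non-empty closed subsets of $X$ with the Vietoris topology (equivalently, the topology of the Hausdorff metric), and $\mathcal{C}(X)\subseteq 2^X$ is the subspace of all subcontinua of $X$. For $B\in 2^X\setminus\{X\}$ and $x\in X\setminus B$, $B$ does not block $\{x\}$ if the union of all subcontinua of $X$ that contain $x$ and are contained in $X\setminus B$ is dense in $X$. $\mathcal{NB}(\mathcal{F}_1(X))$ is the collection of all $B\in 2^X\setminus\{X\}$ such that $B$ does not block $\{x\}$ for each $x\in X\setminus B$. $\mathcal{NB}^{\ast}(\mathcal{F}_1(X))$ is the collection of all $B\in 2^X\setminus\{X\}$ such that $B$ does not block $\{x\}$ for some $x\in X\setminus B$. $\mathcal{NWC}(X)$ is the collection of all $A\in 2^X\setminus\{X\}$ such that $A$ has empty interior in $X$ and $A$ is a non-weak cut set of $X$, i.e. any two points of $X\setminus A$ belong to a subcontinuum of $X$ contained in $X\setminus A$. $\mathcal{S}(X)$ is the collection of all shore sets of $X$, i.e. all $A\in 2^X\setminus\{X\}$ for which there is a sequence $(C_n)_{n\in\mathbb{N}}$ in $\mathcal{C}(X)$ such that $\lim C_n=X$ in $2^X$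 and each $C_n$ is contained in $X\setminus A$. *)

(* Defs.v *)
From HB Require Import structures.
From mathcomp Require Import all_boot all_order all_algebra.
From mathcomp Require Import all_classical all_reals all_analysis.

Set Implicit Arguments.
Unset Strict Implicit.
Unset Printing Implicit Defensive.

Local Open Scope classical_set_scope.

(* The empty space is not excluded: there hyperspace X is an empty type. *)
Definition continuum (R : realType) (X : metricType R) : Prop :=
  compact [set: X] /\ connected [set: X].

Definition subcontinuum (X : topologicalType) (C : set X) : Prop :=
  [/\ C !=set0, closed C & connected C].

(* The hyperspace 2^X. *)
Record hyperspace (X : topologicalType) := Hyperspace {
  hyperset :> set X;
  hyperset_closed : closed hyperset;
  hyperset_neq0 : hyperset !=set0 }.

HB.instance Definition _ (X : topologicalType) := gen_eqMixin (hyperspace X).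
HB.instance Definition _ (X : topologicalType) :=
  gen_choiceMixin (hyperspace X).

Lemma hyperspace_eqP (X : topologicalType) (A B : hyperspace X) :
  A = B <-> (A : set X) = (B : set X).
Proof.
split=> [->//|]; case: A B => [A cA A0] [B cB B0] /= AB.
by subst B; congr Hyperspace; exact: Prop_irrelevance.
Qed.

(* The sets {A | A `<=` U} and {A | A meets U}, for U open in X, form a subbase
   of the Vietoris topology. *)
Definition vietoris_subbase (X : topologicalType) : set (set (hyperspace X)) :=
  [set W | exists2 U : set X, open U &
     W = [set A : hyperspace X | A `<=` U] \/
     W = [set A : hyperspace X | (A `&` U) !=set0]].

HB.instance Definition _ (X : topologicalType) :=
  isSubBaseTopological.Build (hyperspace X) (@vietoris_subbase X) id.

Lemma hyperspace_setT_neq0 (X : topologicalType) (A : hyperspace X) :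
  [set: X] !=set0.
Proof. by have [x _] := hyperset_neq0 A; exists x. Qed.

(* X itself as a point of 2^X. *)
Definition hyperT (X : topologicalType) (X0 : [set: X] !=set0) : hyperspace X :=
  Hyperspace (@closedT X) X0.

(* The hyperspace C(X), as a subset of 2^X. *)
Definition subcontinua (X : topologicalType) : set (hyperspace X) :=
  [set C : hyperspace X | subcontinuum C].

Definition proper_closed (X : topologicalType) : set (hyperspace X) :=
  [set A : hyperspace X | (A : set X) <> [set: X]].

(* B does not block {x}; only meaningful for x outside B. *)
Definition does_not_block (X : topologicalType) (B : hyperspace X) (x : X) :
    Prop :=
  dense (\bigcup_(C in [set C : set X |
                        [/\ subcontinuum C, C x & C `<=` ~` B]]) C).

Definition NB (X : topologicalType) : set (hyperspace X) :=
  [set B : hyperspace X | proper_closed B /\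
    forall x, (~` B) x -> does_not_block B x].

Definition NBstar (X : topologicalType) : set (hyperspace X) :=
  [set B : hyperspace X | proper_closed B /\
    exists2 x, (~` B) x & does_not_block B x].

Definition non_weak_cut (X : topologicalType) (A : set X) : Prop :=
  forall x y, (~` A) x -> (~` A) y ->
    exists C : set X, [/\ subcontinuum C, C x, C y & C `<=` ~` A].

Definition NWC (X : topologicalType) : set (hyperspace X) :=
  [set A : hyperspace X |
    [/\ proper_closed A, interior A = set0 & non_weak_cut A]].

Definition shore (X : topologicalType) : set (hyperspace X) :=
  [set A : hyperspace X | proper_closed A /\
    exists C : nat -> hyperspace X,
      [/\ forall n, subcontinua (C n),
          C @ \oo --> hyperT (hyperspace_setT_neq0 A) &
          forall n, C n `<=` ~` A]].

(* Main.v *)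
From HB Require Import structures.
Require Import Defs.
From mathcomp Require Import all_boot all_order all_algebra.
From mathcomp Require Import all_classical all_reals all_analysis.

(** Call q a non-block point when {q} belongs to NB*, and let F be the set of
    these points; it is finite because NB* is.  Everything rests on the
    following consequence of q not being in F (lemma [gate]): for every z <> q
    the subcontinua through z that avoid q do not fill a dense set, so there is
    a non-empty open set W such that a subcontinuum through z can only meet W by
    passing through q.  A continuum with two points has no finite open set, so
    points outside F are available in every non-empty open set.

    The inclusions of NWC in NB and of NB in NB* hold in every space, and that
    of NB* in the shore sets in every continuum: a countable pi-base provides
    the sequence.

    From NB* to NWC ([NBstar_sub_NWC]): let A be in NB* with witness z, so that
    the subcontinua through z missing A have a dense union.  For q outside F
    one of them meets the open set W of the pair (z, q), hence contains q.  Thus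
    z is joined to every point outside F by a continuum missing A.  A point of F
    outside A is joined to some point outside F by a small continuum, which
    exists by boundary bumping and is infinite.

    From shore sets to NB* ([shore_sub_NBstar]): let C n tend to X and miss A.
    If some z outside F lies in infinitely many C n, then each r outside F lies
    in one of these C n as well, because C n eventually meets the open set W of
    the pair (z, r); so z witnesses that A is in NB*.  Otherwise every point
    outside F is eventually missed, and then every proper subcontinuum K is
    nowhere dense.  Indeed, if K had interior, take z in that interior and r
    outside K, both outside F: for n large, K together with C n is a
    subcontinuum through z which meets W but misses r.  In such an
    (indecomposable) continuum every point is a non-block point
    ([indecomposable_non_block]): the union of the proper subcontinua through r
    is meager, and a point z outside it reaches a dense set without meeting r.
    This contradicts the finiteness of F. *)

Set Implicit Arguments.
Unset Strict Implicit.
Unset Printing Implicit Defensive.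

Local Open Scope classical_set_scope.

(** * Compact Hausdorff spaces: boundary bumping and the Baire property *)

(** Otherwise the sets [A] minus [O] form a filter base of non-empty closed sets,
    and a cluster point of it lies in every [A] but not in [O]. *)
Lemma compact_filtered_sub_open (T : topologicalType) (D : set (set T))
    (O : set T) :
  compact [set: T] -> D !=set0 -> D `<=` closed -> setI_closed D -> open O ->
  \bigcap_(A in D) A `<=` O -> exists2 A, D A & A `<=` O.
Proof.
move=> cT [A0 DA0] Dcl DI oO DO; apply: contrapT => nDO.
pose F := filter_from D (fun A => A `\` O).
have FF : ProperFilter F.
  apply: filter_from_proper => [|A DA].
    apply: filter_from_filter; first by exists A0.
    move=> A B DA DB; exists (A `&` B); first exact: DI.
    by move=> x [[Ax Bx] nOx].
  apply: contrapT => A0'; apply: nDO; exists A => // x Ax.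
  by apply: contrapT => nOx; apply: A0'; exists x.
have [p [_ clp]] := cT F FF filterT.
have pin A : D A -> (A `\` O) p.
  move=> DA; have cA : closed (A `\` O).
    by rewrite setDE; apply: closedI; [exact: Dcl|exact: open_closedC].
  by apply: cA => N Np; apply: clp => //; exists A.
by have [_] := pin _ DA0; apply; apply: DO => A /pin[].
Qed.

(** The continuum is the component K of z in the complement Y of U.  The sets
    relatively clopen in Y that contain z intersect in a connected set Q, so
    that Q lies in K: by normality and compactness, a splitting of Q into two
    closed parts would already split one of these clopen sets.  If K missed the
    closure of U, one of these clopen sets would miss it too, and would then be
    clopen in the whole space. *)
Lemma boundary_bumping (T : topologicalType) (U : set T) (z : T) :
  hausdorff_space T -> compact [set: T] -> connected [set: T] ->
  open U -> U !=set0 -> ~ U z ->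
  exists C, [/\ subcontinuum C, C z, C `<=` ~` U & C `&` closure U !=set0].
Proof.
move=> hT cT coT oU [u Uu] nUz.
have normT := compact_normal hT cT.
pose Y := ~` U; have cY : closed Y by exact: open_closedC.
suff K0 : connected_component Y z `&` closure U !=set0.
  exists (connected_component Y z); split=> //.
  - split; last exact: component_connected.
      by exists z; exact: connected_component_refl.
    exact: component_closed.
  - exact: connected_component_refl.
  - exact: connected_component_sub.
pose D := [set A : set T | [/\ A z, A `<=` Y, closed A & closed (Y `\` A)]].
have DY : D Y by split=> //; rewrite setDv; exact: closed0.
have DI : setI_closed D.
  move=> A B [Az AY cA cA'] [Bz BY cB cB']; split=> //.
  - by move=> x [/AY].
  - exact: closedI.
  - by rewrite setDIr; exact: closedU.
have Dcl : D `<=` closed by move=> A [].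
pose Q := \bigcap_(A in D) A.
have Qz : Q z by move=> A [].
have cQ : closed Q by apply: closed_bigI => A /Dcl.
have QY : Q `<=` Y by move=> x /(_ _ DY).
(* The part in G of a clopen set covered by the disjoint open sets G and H is
   itself clopen, so it occurs in the intersection defining Q. *)
have Qsub G H : open G -> open H -> G `&` H = set0 -> Q `<=` G `|` H ->
    G z -> Q `<=` G.
  move=> oG oH GH QGH Gz.
  have [|A [Az AY cA cA'] AGH] :=
    compact_filtered_sub_open cT (ex_intro _ Y DY) Dcl DI _ QGH.
    exact: openU.
  have DAG : D (A `&` G).
    split=> //; first by move=> x [/AY].
      rewrite (_ : A `&` G = A `&` ~` H).
        by apply: closedI => //; exact: open_closedC.
      apply/seteqP; split=> x [Ax]; split=> //.
        by move=> Hx; have : (G `&` H) x by []; rewrite GH.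
      by have [] := AGH _ Ax.
    rewrite (_ : Y `\` (A `&` G) = (Y `\` A) `|` (A `&` ~` G)).
      by apply: closedU => //; apply: closedI => //; exact: open_closedC.
    apply/seteqP; split=> [x [Yx]|x [[Yx nAx]|[Ax nGx]]].
    - move=> /not_andP[nAx|nGx]; first by left.
      by have [Ax|nAx] := pselect (A x); [right|left].
    - by split=> // -[].
    - by split; [exact: AY|case].
  by move=> x /(_ _ DAG) [].
have conQ : connected Q.
  move=> B [b Bb] [C oC BE] [C' cC' BE'].
  have cB : closed B by rewrite BE'; exact: closedI.
  have cB' : closed (Q `\` B).
    rewrite (_ : Q `\` B = Q `&` ~` C).
      by apply: closedI => //; exact: open_closedC.
    rewrite BE; apply/seteqP; split=> x [Qx nx]; split=> //; last by case.
    by move=> Cx; apply: nx.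
  have [G [H [oG oH BG QH GH]]] : exists G H : set T,
      [/\ open G, open H, B `<=` G, Q `\` B `<=` H & G `&` H = set0].
    have [|V BV VB] := normT B cB (~` (Q `\` B)).
      apply/set_nbhsP; exists (~` (Q `\` B)); split=> //.
        exact: closed_openC.
      by move=> x Bx [].
    move/set_nbhsP: BV => [W [oW BW WV]].
    exists W, (~` closure W); split=> //.
    - exact/closed_openC/closed_closure.
    - move=> x QBx clWx; apply: (VB x) => //.
      exact: closureS clWx.
    - by apply/seteqP; split=> // x [Wx]; apply; exact: subset_closure.
  have QGH : Q `<=` G `|` H.
    move=> x Qx; have [Bx|nBx] := pselect (B x); [left|right]; first exact: BG.
    exact: QH.
  apply/seteqP; split=> [x|x Qx]; first by rewrite BE => -[].
  have [Gz|Hz] := QGH _ Qz.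
    apply: contrapT => nBx; have : (G `&` H) x; last by rewrite GH.
    by split; [exact: (Qsub _ _ oG oH GH QGH Gz)|exact: QH].
  have Qb : Q b by move: Bb; rewrite BE => -[].
  have : (G `&` H) b; last by rewrite GH.
  split; first exact: BG.
  by apply: (Qsub _ _ oH oG) Qb => //; rewrite 1?setIC// setUC.
have QK : Q `<=` connected_component Y z by exact: connected_component_max.
apply: contrapT => nK.
have [A [Az AY cA cA'] AU] :
    exists2 A, D A & A `<=` ~` closure U.
  apply: (compact_filtered_sub_open cT (ex_intro _ Y DY) Dcl DI).
    exact/closed_openC/closed_closure.
  by move=> x /QK Kx clUx; apply: nK; exists x.
(* A is disjoint from the closure of U, so being clopen in Y it is open in T. *)
have oA : open A.
  rewrite -closedC (_ : ~` A = closure U `|` (Y `\` A)).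
    by apply: closedU => //; exact: closed_closure.
  apply/seteqP; split=> [x nAx|x [clUx /AU//|[]//]].
  have [Ux|nUx] := pselect (U x); [left; exact: subset_closure|by right].
have AT : A = setT.
  by apply: coT; [exists z|exists A; rewrite ?setTI|exists A; rewrite ?setTI].
by have /AY : A u by rewrite AT.
Qed.

(** Baire's theorem: nested open sets are chosen so that the closure of each one
    lies in the preceding one and misses one more of the [F n]; compactness gives
    a point common to all of them. *)
Lemma compact_hausdorff_baire (T : topologicalType) (F : nat -> set T) (t : T) :
  hausdorff_space T -> compact [set: T] ->
  (forall n, closed (F n) /\ interior (F n) = set0) ->
  exists x, forall n, ~ F n x.
Proof.
move=> hT cT hF.
have step n (V : set T) : exists W, open V -> V !=set0 ->
    [/\ open W, W !=set0, closure W `<=` V & closure W `<=` ~` F n].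
  have [[oV V0]|nV] := pselect (open V /\ V !=set0); last first.
    by exists V => oV V0; exfalso; apply: nV.
  have [cF F0] := hF n.
  have [v Vv nFv] : exists2 v, V v & ~ F n v.
    apply: contrapT => VF; have [v Vv] := V0.
    have : interior (F n) v; last by rewrite F0.
    rewrite /interior nbhsE; exists V => // w Vw.
    by apply: contrapT => nFw; apply: VF; exists w.
  have [|N] := @compact_regular T v setT hT cT filterT (V `\` F n).
    apply: open_nbhs_nbhs; split=> //; rewrite setDE.
    by apply: openI => //; exact: closed_openC.
  rewrite /= nbhsE => -[W [oW Wv] WN] NV.
  exists W => _ _; split=> //; first by exists v.
    by move=> x /(closureS WN)/NV[].
  by move=> x /(closureS WN)/NV[].
have [f Hf] := choice (fun p : nat * set T => step p.1 p.2).
pose V := fix V n := if n is m.+1 then f (m, V m) else [set: T].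
have HV n : open (V n) /\ V n !=set0.
  elim: n => [|n [oV V0]]; first by split; [exact: openT|exists t].
  by have [] := Hf (n, V n) oV V0.
have HS n : closure (V n.+1) `<=` V n /\ closure (V n.+1) `<=` ~` F n.
  by have [oV V0] := HV n; have [] := Hf (n, V n) oV V0.
have Vmon n m : (n <= m)%N -> closure (V m) `<=` closure (V n).
  move=> /subnK <-; elim: (m - n)%N => // k IH; apply: subset_trans IH.
  by rewrite addSn => x /(HS _).1; exact: subset_closure.
pose D := [set closure (V n) | n in [set: nat]].
apply: contrapT => nx.
have [|||||A [n _ <-]] := @compact_filtered_sub_open T D set0 cT.
- by exists (closure (V 0%N)); exists 0%N.
- by move=> _ [n _ <-]; exact: closed_closure.
- move=> _ _ [n _ <-] [m _ <-]; exists (maxn n m) => //.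
  apply/seteqP; split=> [x Vx|x [Vn Vm]].
    by split; apply: Vmon Vx; rewrite ?leq_maxl ?leq_maxr.
  by have [_|_] := leqP m n.
- exact: open0.
- move=> x Dx; apply: nx; exists x => n; apply: (HS n).2.
  by apply: Dx; exists n.+1.
- have [v Vv] := (HV n).2.
  by move=> /(_ v); apply; exact: subset_closure.
Qed.

(** A countable base with the empty set removed, enumerated by the integers. The point
    [x0] makes [X] a pointed space. *)
Lemma compact_metric_pi_base (R : realType) (X : metricType R) (x0 : X) :
  compact [set: X] ->
  exists U : nat -> set X, (forall n, open (U n) /\ U n !=set0) /\
    forall O, open O -> O !=set0 -> exists n, U n `<=` O.
Proof.
move=> cX.
pose P : pseudoPMetricType R := HB.pack_for (pseudoPMetricType R) X
  (isPointed.Build X x0).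
have [B cB [oB bB]] := @compact_second_countable R P cX.
pose B' := [set V | B V /\ V !=set0].
have B'0 : exists V, B' V.
  by have [V [BV Vx] _] := bB x0 setT filterT; exists V; split=> //; exists x0.
have cB' : countable B' by apply: sub_countable cB; apply: subset_card_le => V [].
have [B'e|[f]] := pfcard_geP cB'.
  by case: B'0 => V; rewrite B'e.
exists f; split=> [n|O oO [x Ox]].
  have [BV V0] : B' (f n) by exact: funS.
  by split=> //; exact: oB.
have [V [BV Vx] VO] := bB x O (open_nbhs_nbhs (conj oO Ox)).
have [n _ fn] : range f V by apply: surj; split=> //; exists x.
by exists n; rewrite fn.
Qed.

(** * Convergence in the Vietoris topology *)

Lemma cvg_vietoris (X : topologicalType) (F : set_system (hyperspace X))
    (A : hyperspace X) :
  Filter F -> (forall W, vietoris_subbase W -> W A -> F W) -> F --> A.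
Proof.
move=> FF h N; rewrite nbhsE => -[B [oB BA] BN]; apply: filterS BN _.
case: oB BA => D Dsub <- [V DV VA]; have [E Esub EV] := Dsub _ DV.
apply: (@filterS _ _ _ V); first by move=> C VC; exists V.
rewrite -EV; apply: filter_bigI => W EW; apply: h.
  by have := Esub _ EW; rewrite inE.
by move: VA; rewrite -EV; apply.
Qed.

Lemma open_vietoris_meet (X : topologicalType) (U : set X) : open U ->
  open [set A : hyperspace X | (A `&` U) !=set0].
Proof.
move=> oU; pose W := [set A : hyperspace X | (A `&` U) !=set0].
exists [set W]; last by rewrite bigcup_set1.
move=> _ ->; apply: (@finI_from1 _ _ (@vietoris_subbase X) id).
by exists U => //; right.
Qed.

(** * Infinitude of nondegenerate connected sets *)

Lemma metric_finite_closed (R : realType) (X : metricType R) (A : set X) :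
  finite_set A -> closed A.
Proof.
move: A; apply/accessible_finite_set_closed.
by apply: hausdorff_accessible; exact: metric_hausdorff.
Qed.

Lemma closed_pt (R : realType) (X : metricType R) (x : X) : closed [set x].
Proof. by apply: (@metric_finite_closed R X); exact: finite_set1. Qed.

Lemma connected_infinite (R : realType) (X : metricType R) (a b : X)
    (K : set X) :
  connected K -> a <> b -> K a -> K b -> infinite_set K.
Proof.
move=> coK ab Ka Kb finK; apply: ab.
have aK : [set a] = K.
  apply: coK; first by exists a.
    exists (~` (K `\` [set a])).
      by apply: closed_openC; apply: (@metric_finite_closed R X); exact: finite_setD.
    apply/seteqP; split=> [_ ->|x [Kx nKx]]; first by split=> // -[_]; apply.
    by apply: contrapT => xa; exact: nKx.
  exists [set a]; first exact: closed_pt.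
  by apply/seteqP; split=> [_ ->|x []].
by have : [set a] b by rewrite aK.
Qed.

(** A finite open set would be clopen, hence the whole space, which is itself
    infinite. *)
Lemma continuum_open_infinite (R : realType) (X : metricType R) (a b : X)
    (O : set X) :
  connected [set: X] -> a <> b -> open O -> O !=set0 -> infinite_set O.
Proof.
move=> coX ab oO O0 finO.
suff OT : O = setT.
  by apply: (connected_infinite coX ab _ _ _) => //; rewrite -OT.
apply: coX => //; exists O; rewrite ?setTI//; exact: metric_finite_closed.
Qed.

(** * Points of a continuum in which proper subcontinua are nowhere dense *)

Lemma subcontinuumU (X : topologicalType) (C D : set X) :
  subcontinuum C -> subcontinuum D -> C `&` D !=set0 ->
  subcontinuum (C `|` D).
Proof.
move=> [[x Cx] cC coC] [_ cD coD] CD; split; first by exists x; left.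
  exact: closedU.
exact: connectedU.
Qed.

(** The composant-like set of the points that can be joined to [x] off [B]; its
    density is, by definition, that [B] does not block [x]. *)
Definition reach (X : topologicalType) (B : set X) (x : X) : set X :=
  \bigcup_(C in [set C : set X | [/\ subcontinuum C, C x & C `<=` ~` B]]) C.

(** Each proper subcontinuum through r misses a member of the pi-base, so it lies
    in one of countably many nowhere dense components.  By Baire some z
    lies in none of them, so that no proper subcontinuum contains both z and r.
    On the other hand boundary bumping yields, next to any open set, a proper
    subcontinuum through z. *)
Lemma indecomposable_non_block (R : realType) (X : metricType R) (r : X) :
  continuum X -> (exists a, a <> r) ->
  (forall K : set X, subcontinuum K -> K <> setT -> interior K = set0) ->
  exists2 z, z <> r & dense (reach [set r] z).
Proof.
move=> [cX coX] [a ar] thin.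
have hX := @metric_hausdorff R X.
have [U [U0 Ubase]] := compact_metric_pi_base r cX.
pose F n := connected_component (~` U n) r.
have [n|z Fz] := @compact_hausdorff_baire X F r hX cX.
  have [oU [u Uu]] := U0 n.
  split; first by apply: component_closed; exact: open_closedC.
  have [Ur|nUr] := pselect ((~` U n) r); last first.
    by rewrite /F connected_component_out// interior0.
  apply: thin.
    split; first by exists r; exact: connected_component_refl.
      by apply: component_closed; exact: open_closedC.
    exact: component_connected.
  by move=> FT; have /connected_component_sub : F n u by rewrite FT.
have sep (C : set X) n : connected C -> C z -> C `<=` ~` U n -> ~ C r.
  by move=> coC Cz CU Cr; apply: (Fz n); exists C.
(* The singleton {r} is one of the proper subcontinua through r. *)
have zr : z <> r.
  move=> zr.
  have [|n Un] := Ubase (~` [set r]) (closed_openC (@closed_pt R X r)).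
    by exists a.
  apply: (sep [set r] n) => //; first exact: connected1.
  by move=> _ -> Ur; exact: (Un r).
exists z; first exact: zr.
move=> W [u Wu] oW.
have [Wz|nWz] := pselect (W z).
  exists z; split=> //; exists [set z] => //; split=> //.
    by split; [exists z|exact: closed_pt|exact: connected1].
  by move=> _ ->.
have [N] := uniform_regular (open_nbhs_nbhs (conj oW Wu)).
rewrite nbhsE => -[V [oV Vu] VN] NW.
have clVW : closure V `<=` W by move=> x /(closureS VN)/NW.
have [||C [scC Cz CV [c [Cc clc]]]] := @boundary_bumping X V z hX cX coX oV.
- by exists u.
- by move=> /subset_closure/clVW.
- exists c; split; first exact: clVW.
  exists C => //; split=> // x Cx xr; rewrite xr in Cx.
  have [|n UV] := Ubase V oV; first by exists u.
  have [_ _ coC] := scC.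
  by apply: (sep C n) Cx => // y /CV nVy /UV.
Qed.

(** * Non-block points *)

Definition hyper1 (R : realType) (X : metricType R) (x : X) : hyperspace X :=
  Hyperspace (@closed_pt R X x) (ex_intro _ x erefl).

Definition non_block_pts (R : realType) (X : metricType R) : set X :=
  [set q | @NBstar X (hyper1 q)].

Lemma finite_non_block_pts (R : realType) (X : metricType R) :
  finite_set (@NBstar X) -> finite_set (@non_block_pts R X).
Proof.
move=> fin; apply: finite_preimage fin => p q _ _ /hyperspace_eqP /= pq.
by have : [set q] p by rewrite -pq.
Qed.

(** If every open set were met by a subcontinuum through [z] off [q], then [z]
    would witness that [q] is a non-block point. *)
Lemma gate (R : realType) (X : metricType R) (q z : X) :
  ~ non_block_pts q -> z <> q ->
  exists O : set X, [/\ open O, O !=set0 &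
    forall C, subcontinuum C -> C z -> C `&` O !=set0 -> C q].
Proof.
move=> nq zq.
have [|O [[u [oO Ou]] OR]] := @denseNE X (reach [set q] z).
  move=> dz; apply: nq; split=> /=.
    by move=> qT; apply: zq; have : (hyper1 q : set X) z by rewrite qT.
  by exists z.
exists O; split=> //; first by exists u.
move=> C scC Cz [c [Cc Oc]]; apply: contrapT => nCq.
have : (O `&` reach [set q] z) c; last by rewrite OR.
by split=> //; exists C => //; split=> // x Cx /= xq; apply: nCq; rewrite -xq.
Qed.

(** A proper non-empty set excludes the degenerate continua. *)
Lemma proper_two_points (X : topologicalType) (A : hyperspace X) :
  proper_closed A -> exists a b : X, a <> b.
Proof.
move=> AT; have [a Aa] := hyperset_neq0 A.
apply: contrapT => ab; apply: AT; apply/seteqP; split=> // x _.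
by apply: contrapT => nAx; apply: ab; exists a, x => ax; apply: nAx; rewrite -ax.
Qed.

Lemma pick_outside (R : realType) (X : metricType R) (a b : X) (O G : set X) :
  connected [set: X] -> a <> b -> open O -> O !=set0 -> finite_set G ->
  exists2 x, O x & ~ G x.
Proof.
move=> coX ab oO O0 finG.
have /infinite_setN0 [x [Ox nGx]] :=
  infinite_setD (continuum_open_infinite coX ab oO O0) finG.
by exists x.
Qed.

(** * The four families *)

Lemma NWC_sub_NB (X : topologicalType) : @NWC X `<=` @NB X.
Proof.
move=> A [pA A0 nwc]; split=> // x nAx W [u Wu] oW.
have [y Wy nAy] : exists2 y, W y & (~` A) y.
  apply: contrapT => WA; have : interior A u; last by rewrite A0.
  rewrite /interior nbhsE; exists W => // y Wy.
  by apply: contrapT => nAy; apply: WA; exists y.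
have [C [scC Cx Cy CA]] := nwc x y nAx nAy.
by exists y; split=> //; exists C.
Qed.

Lemma NB_sub_NBstar (X : topologicalType) : @NB X `<=` @NBstar X.
Proof.
move=> A [pA h]; split=> //.
have [x nAx] : exists x, (~` A) x.
  apply: contrapT => nA; apply: pA; apply/seteqP; split=> // x _.
  by apply: contrapT => nAx; apply: nA; exists x.
by exists x => //; exact: h.
Qed.

(** Off F, density of the set reached from z is enough to reach a point, by
    [gate].  A point of F outside A is first joined to a point off F within a
    closed neighbourhood missing A. *)
Lemma NBstar_sub_NWC (R : realType) (X : metricType R) :
  continuum X -> finite_set (@NBstar X) -> @NBstar X `<=` @NWC X.
Proof.
move=> [cX coX] /finite_non_block_pts finF A [pA [z nAz dz]].
have [a [b ab]] := proper_two_points pA.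
pose F := @non_block_pts R X.
have nF x : ~ F x -> reach A z x.
  move=> nFx; have [xz|xz] := pselect (z = x).
    have [w [_ [C [scC Cz CA] _]]] := dz setT (ex_intro _ z I) openT.
    by exists C => //; rewrite -xz.
  have [W [oW W0 WC]] := gate nFx xz.
  have [w [Ww [C [scC Cz CA] Cw]]] := dz W W0 oW.
  by exists C => //; apply: WC => //; exists w.
have reach_all x : (~` A) x -> reach A z x.
  move=> nAx.
  have [N] := uniform_regular
    (open_nbhs_nbhs (conj (closed_openC (@hyperset_closed X A)) nAx)).
  rewrite nbhsE => -[V [oV Vx] VN] NA.
  (* Bumping is applied to the complement of the closure of V, so that the
     continuum obtained stays in the closure of V, hence off A. *)
  have xV y : V y -> ~ (closure (~` closure V)) y.
    move=> Vy /(_ V (open_nbhs_nbhs (conj oV Vy)))[w [/= nVw Vw]].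
    by apply: nVw; exact: subset_closure.
  have clVA : closure V `<=` ~` A by move=> y /(closureS VN)/NA.
  have [|||C [scC Cx CV [c [Cc clc]]]] :=
    @boundary_bumping X (~` closure V) x (@metric_hausdorff R X) cX coX.
  - exact/closed_openC/closed_closure.
  - by have [y Ay] := hyperset_neq0 A; exists y => /clVA.
  - by apply; exact: subset_closure.
  rewrite setCK in CV.
  have [_ _ coC] := scC.
  have xc : x <> c by move=> xc; apply: (xV x) => //; rewrite xc.
  have /infinite_setN0 [w [Cw nFw]] :=
    infinite_setD (connected_infinite coC xc Cx Cc) finF.
  have [D [scD Dz DA] Dw] := nF w nFw.
  exists (C `|` D); last by left.
  split; [|by right|by rewrite subUset; split=> // y /CV/clVA].
  by apply: subcontinuumU => //; exists w.
split=> //.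
  rewrite -subset0 => x.
  rewrite /interior nbhsE => -[W [oW Wx] WA].
  have [w [Ww [C [_ _ CA] Cw]]] := dz W (ex_intro _ x Wx) oW.
  by have := CA _ Cw (WA _ Ww).
move=> x y /reach_all[C [scC Cz CA] Cx] /reach_all[D [scD Dz DA] Dy].
exists (C `|` D); split; [|by left|by right|by rewrite subUset].
by apply: subcontinuumU => //; exists z.
Qed.

(** A witness z reaches every member of a countable pi-base; the union L n of the
    continua reaching the first n+1 members is connected through z. *)
Lemma NBstar_sub_shore (R : realType) (X : metricType R) :
  continuum X -> @NBstar X `<=` @shore X.
Proof.
move=> [cX coX] A [pA [z nAz dz]]; split=> //.
have [U [U0 Ubase]] := compact_metric_pi_base z cX.
have /choice[K HK] n : exists C : set X,
    [/\ subcontinuum C, C z, C `<=` ~` A & C `&` U n !=set0].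
  have [oU Un0] := U0 n.
  by have [w [Uw [C [scC Cz CA] Cw]]] := dz _ Un0 oU; exists C; split=> //; exists w.
pose L n := \bigcup_(i in `I_n.+1) K i.
have scL n : subcontinuum (L n).
  split.
  - by exists z; exists n => //=; have [] := HK n.
  - by apply: closed_bigcup => // i _; have [[]] := HK i.
  - apply: bigcup_connected => [|i _]; last by have [[]] := HK i.
    by exists z => i _; have [] := HK i.
exists (fun n => Hyperspace (let: And3 _ cL _ := scL n in cL)
                   (let: And3 L0 _ _ := scL n in L0)).
split=> [//||n x [i _]]; last by have [_ _ + _] := HK i; apply.
apply: cvg_vietoris => _ [V oV [->|->]] /=.
  by move=> VT; near=> n => x _; exact: VT.
move=> [x [_ Vx]]; have [|m UmV] := Ubase V oV; first by exists x.
exists m => // n /= mn.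
have [_ _ _ [w [Kw Uw]]] := HK m.
by exists w; split; [exists m|exact: UmV].
Unshelve. all: by end_near. Qed.

(** Either some point off F lies in infinitely many [C n], and then it is a
    witness for [A]; or every proper subcontinuum is nowhere dense, which makes
    every point a non-block point. *)
Lemma shore_sub_NBstar (R : realType) (X : metricType R) :
  continuum X -> finite_set (@NBstar X) -> @shore X `<=` @NBstar X.
Proof.
move=> contX finN A [pA [C [scC cvC CA]]]; have [cX coX] := contX.
have finF := @finite_non_block_pts R X finN.
have [a [b ab]] := proper_two_points pA.
pose F := @non_block_pts R X.
have meetC (W : set X) : open W -> W !=set0 ->
    exists N, forall n, (N <= n)%N -> C n `&` W !=set0.
  move=> oW [w Ww].
  have [|N _ NW] := cvC [set B : hyperspace X | (B `&` W) !=set0].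
    by apply: open_nbhs_nbhs; split; [exact: open_vietoris_meet|exists w].
  by exists N => n /NW.
have [[z [nFz zC]]|nz] := pselect (exists z, ~ F z /\
    forall N, exists2 n, (N <= n)%N & (C n : set X) z).
  split=> //; exists z; first by have [n _ Cz] := zC 0%N; exact: CA Cz.
  move=> W W0 oW.
  have finFz : finite_set (F `|` [set z]) by rewrite finite_setU.
  have [r Wr /not_orP[nFr rz]] := pick_outside coX ab oW W0 finFz.
  have [|W' [oW' W'0 gateW']] := @gate R X r z nFr; first by move=> /esym.
  have [N NW'] := meetC W' oW' W'0.
  have [n Nn Cz] := zC N.
  exists r; split=> //; exists (C n); last exact: (gateW' _ (scC n) Cz (NW' _ Nn)).
  by split=> //; exact: scC.
exfalso.
have thin (K : set X) : subcontinuum K -> K <> setT -> interior K = set0.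
  move=> scK KT; apply: contrapT => /eqP/set0P iK0.
  have [z iKz nFz] := pick_outside coX ab (@open_interior _ K) iK0 finF.
  have Kz := interior_subset iKz.
  have [_ cK coK] := scK.
  have [||r nKr nFr] := @pick_outside R X a b (~` K) F coX ab _ _ finF.
  - exact: closed_openC.
  - apply: contrapT => nK; apply: KT; apply/seteqP; split=> // x _.
    by apply: contrapT => nKx; apply: nK; exists x.
  have [|W [oW W0 gateW]] := @gate R X r z nFr; first by move=> zr; rewrite zr in Kz.
  have [N1 CW] := meetC W oW W0.
  have [N2 CK] := meetC _ (@open_interior _ K) iK0.
  have [N3 Cr] : exists N, forall n, (N <= n)%N -> ~ (C n : set X) r.
    apply: contrapT => h; apply: nz; exists r; split=> // N.
    apply: contrapT => h'; apply: h; exists N => n Nn Cr; apply: h'.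
    by exists n.
  pose n := maxn N1 (maxn N2 N3).
  have [w [Cw Ww]] : C n `&` W !=set0 by apply: CW; rewrite leq_maxl.
  have [k [Ck iKk]] : C n `&` interior K !=set0.
    by apply: CK; rewrite /n leq_max leq_maxl orbT.
  have : (K `|` C n) r.
    apply: gateW; [|by left|by exists w; split=> //; right].
    apply: subcontinuumU => //; first exact: scC.
    by exists k; split=> //; exact: interior_subset.
  case=> //; apply: Cr; by rewrite /n !leq_max leqnn !orbT.
have [r _ nFr] := pick_outside coX ab openT (ex_intro _ a I) finF.
apply: nFr.
have [|z zr dz] := indecomposable_non_block (r := r) contX _ thin.
  have [ar|ar] := pselect (a = r); last by exists a.
  by exists b => br; apply: ab; rewrite ar br.
split; last by exists z.
by move=> rT; apply: zr; have : (hyper1 r : set X) z by rewrite rT.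
Qed.

Theorem theorem3p2 (R : realType) (X : metricType R)
    (continuumX : continuum X) (finite_NBstar : finite_set (@NBstar X)) :
  finite_set (@shore X) /\
  [/\ @NWC X = @NB X, @NB X = @NBstar X & @NBstar X = @shore X].
Proof.
have NWC_NB := @NWC_sub_NB X.
have NB_NBstar := @NB_sub_NBstar X.
have NBstar_NWC := NBstar_sub_NWC continuumX finite_NBstar.
have shoreE : @NBstar X = @shore X.
  by apply/seteqP; split; [exact: NBstar_sub_shore|exact: shore_sub_NBstar].
split; first by rewrite -shoreE.
split=> //; apply/seteqP; split=> //.
  exact: subset_trans NB_NBstar NBstar_NWC.
exact: subset_trans NBstar_NWC NWC_NB.
Qed.
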